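(* For all integers $k\ge 0$ and $n\ge 2k$ and all real $x,y$, $$(-xy)^k(y-x)^{n-2k}=\frac{(k!)^2}{(n)_{2k}}\sum_{j=0}^{n}\binom{n}{j}(-1)^{n-j}B_k^j(x)\,B_k^{n-j}(y),$$ where $(n)_{2k}=n(n-1)\cdots(n-2k+1)$, $(n)_0=1$, and $B_k^n$ denotes the Bernstein basis function.
   Context: The Bernstein basis functions are $B_k^n(x)=\binom{n}{k}x^k(1-x)^{n-k}$ for integers $0\le k\le n$, with the convention that $B_k^n(x)=0$ when $k<0$ or $k>n$ (and $0^0=1$). *)

(* Defs.v *)
From mathcomp Require Import all_boot all_order all_algebra.
From mathcomp Require Import reals.

Set Implicit Arguments.
Unset Strict Implicit.
Unset Printing Implicit Defensive.

Import Order.TTheory GRing.Theory Num.Theory.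
Local Open Scope ring_scope.

(* The convention B_k^n = 0 for k > n needs no case split: 'C(n, k) = 0 there,
   so the truncated exponent n - k is harmless.  Also x ^+ 0 = 1 for every x,
   including x = 0. *)
Definition bernstein (R : realType) (n k : nat) (x : R) : R :=
  'C(n, k)%:R * x ^+ k * (1 - x) ^+ (n - k).

(* Main.v *)
(* A term of the sum vanishes unless k <= j <= n - k.  For j = k + i and
   n = 2k + m, the product of the three binomial coefficients and of (k!)^2 is
   (n)_{2k} 'C(m, i), so what remains is (- x y)^k times the binomial expansion
   of ((1 - x) - (1 - y))^m. *)
Require Import Defs.
From mathcomp Require Import all_boot all_order all_algebra.
From mathcomp Require Import reals.
From mathcomp Require Import ring zify.

Set Implicit Arguments.
Unset Strict Implicit.
Unset Printing Implicit Defensive.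

Import Order.TTheory GRing.Theory Num.Theory.
Local Open Scope ring_scope.

(** Multiplied by [i! * l!], either side collapses to the factorial of [(k + i) + (k + l)]. *)
Lemma fact_sqr_bin_mul3 (k i l : nat) :
  (k`! * k`! *
     ('C((k + i) + (k + l), k + i) * 'C(k + i, k) * 'C(k + l, k)) =
   ((k + i) + (k + l)) ^_ (2 * k) * 'C(i + l, i))%N.
Proof.
have := bin_fact (leq_addr (k + l) (k + i)).
have := bin_fact (leq_addr i k); have := bin_fact (leq_addr l k).
have := bin_fact (leq_addr l i).
have := @ffact_fact ((k + i) + (k + l)) (2 * k).
rewrite addnACA mul2n -addnn leq_addr !addKn => /(_ isT).
rewrite -addnACA addKn => <- <- <- <- E.
have il_gt0 : (0 < i`! * l`!)%N by rewrite muln_gt0 !fact_gt0.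
by apply/eqP; rewrite -(eqn_pmul2r il_gt0); apply/eqP; lia.
Qed.

Lemma bernstein_small (R : realType) (n k : nat) (x : R) :
  (n < k)%N -> bernstein n k x = 0.
Proof. by move=> ltnk; rewrite /bernstein bin_small // !mul0r. Qed.

Theorem theorem11 (R : realType) (n k : nat) (hkn : (2 * k <= n)%N) (x y : R) :
  (- (x * y)) ^+ k * (y - x) ^+ (n - 2 * k) =
  (k`!%:R ^+ 2 / (n ^_ (2 * k))%:R) *
  \sum_(0 <= j < n.+1)
     'C(n, j)%:R * (-1) ^+ (n - j) * bernstein j k x * bernstein (n - j) k y.
Proof.
have ffact_neq0 : (n ^_ (2 * k))%:R != 0 :> R.
  by rewrite pnatr_eq0 -lt0n ffact_gt0.
have [m nE] : exists m, n = (k + (k + m))%N.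
  by exists (n - 2 * k)%N; rewrite addnA addnn -mul2n subnKC.
have -> : (n - 2 * k)%N = m by rewrite nE mul2n -addnn addnA addKn.
rewrite (@big_cat_nat _ _ _ k) /=; [|by []|by rewrite nE -addnS leq_addr].
rewrite big_nat big1 ?add0r => [|j /andP[_ ltjk]]; last first.
  by rewrite bernstein_small // mulr0 mul0r.
(* The upper bound is exclusive, so [j = k + m = n - k] is kept; beyond it [n - j < k]. *)
rewrite (@big_cat_nat _ _ _ (k + m.+1)) /=; [|exact: leq_addr|]; last first.
  by rewrite nE -addnS leq_add2l -addnS leq_addl.
rewrite [X in _ = _ * (_ + X)]big_nat [X in _ = _ * (_ + X)]big1 ?addr0; last first.
  move=> j /andP[lej ltj]; rewrite (@bernstein_small _ (n - j)) ?mulr0 //.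
  by rewrite nE in ltj *; lia.
rewrite (big_addn 0 _ k) addKn big_mkord mulr_sumr.
(* With the summands in this order, [exprDn] gives [1 - x] the exponent [i = j - k] and [1 - y] the
   exponent [m - i = n - j - k], as in the Bernstein product. *)
have -> : y - x = - (1 - y) + (1 - x) by ring.
rewrite exprDn mulr_sumr; apply: eq_bigr => -[i ltim] _ /=.
have [l mE] : exists l, m = (i + l)%N.
  by exists (m - i)%N; rewrite subnKC // -ltnS.
have nE' : n = ((k + i) + (k + l))%N by rewrite nE mE; lia.
have -> : (n - (i + k) = k + l)%N by rewrite nE'; lia.
rewrite /bernstein (addnC i k) !addKn mE addKn.
have /(congr1 (fun a => a%:R : R)) := fact_sqr_bin_mul3 k i l.
rewrite -nE' !natrM => binE.
rewrite -mulr_natr -['C(i + l, i)%:R](mulKf ffact_neq0) -binE.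
rewrite [(- (1 - y)) ^+ l]exprNn [(- (x * y)) ^+ k]exprNn exprMn exprD expr2.
by field.
Qed.
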